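(* Let $(p_j)_{j\in\mathbb{Z}}$ be real numbers with $0<p_j\le 1/2$ for all $j\in\mathbb{Z}$ and $\inf_{j\in\mathbb{Z}}p_j<1/2$, and let $\{\mathbf{C}(N);\ N=0,1,2,\ldots\}$ be the anisotropic random walk on $\mathbb{Z}^2$ with parameters $(p_j)_{j\in\mathbb{Z}}$, started at $\mathbf{C}(0)=(0,0)$. Assume that $$\sum_{j=-k}^{k}\frac{1}{p_j}=Ck^{1+A}+O(k^{1+A-\delta}),\qquad k\to\infty,$$ for some constants $C>0$, $A>0$ and $0<\delta\le 1$. Then the walk $\mathbf{C}(\cdot)$ is transient.
   Context: The anisotropic random walk with parameters $(p_j)_{j\in\mathbb{Z}}$ is the time-homogeneous Markov chain $\{\mathbf{C}(N)=(C_1(N),C_2(N));\ N=0,1,2,\ldots\}$ on $\mathbb{Z}^2$ with transition probabilities, for all $(k,j)\in\mathbb{Z}^2$ and $N\ge 0$, $$\mathbf{P}(\mathbf{C}(N+1)=(k+1,j)\mid\mathbf{C}(N)=(k,j))=\mathbf{P}(\mathbf{C}(N+1)=(k-1,j)\mid\mathbf{C}(N)=(k,j))=\tfrac12-p_j,$$ $$\mathbf{P}(\mathbf{C}(N+1)=(k,j+1)\mid\mathbf{C}(N)=(k,j))=\mathbf{P}(\mathbf{C}(N+1)=(k,j-1)\mid\mathbf{C}(N)=(k,j))=p_j.$$ Transient means that, with probability 1, the walk started at the origin returns to the origin only finitely many times. *)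

(* Defs.v *)
From HB Require Import structures.
From mathcomp Require Import all_boot all_order all_algebra.
From mathcomp Require Import all_classical all_reals all_analysis.

Set Implicit Arguments.
Unset Strict Implicit.
Unset Printing Implicit Defensive.

Import Order.TTheory GRing.Theory Num.Theory.
Import numFieldNormedType.Exports.

Local Open Scope classical_set_scope.
Local Open Scope ring_scope.

Definition cond_prob (R : realType) (d : measure_display)
    (Omega : measurableType d) (P : probability Omega R)
    (A B : set Omega) : R :=
  fine (P (A `&` B)) / fine (P B).

Definition history (Omega S : Type) (X : nat -> Omega -> S)
    (x : nat -> S) (N : nat) : set Omega :=
  [set w | forall i, (i <= N)%N -> X i w = x i].

(* The state space S is meant to be countable and discrete, so measurability
   of X N is measurability of its level sets. Only the values x 0, .., x N of
   the sequence x matter. *)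
Definition markov_chain (R : realType) (d : measure_display)
    (Omega : measurableType d) (P : probability Omega R) (S : Type)
    (Q : S -> S -> R) (X : nat -> Omega -> S) : Prop :=
  (forall N s, measurable [set w | X N w = s]) /\
  (forall N (x : nat -> S) (s : S), P (history X x N) != 0%E ->
     cond_prob P [set w | X N.+1 w = s] (history X x N) = Q (x N) s).

(* The four displayed probabilities sum to 1, so every other transition has
   probability 0. *)
Definition anisotropic_transition (R : realType) (p : int -> R)
    (u v : int * int) : R :=
  let: (k, j) := u in
  if (v == (k + 1, j)) || (v == (k - 1, j)) then 2^-1 - p j
  else if (v == (k, j + 1)) || (v == (k, j - 1)) then p j
  else 0.

Definition anisotropic_walk (R : realType) (d : measure_display)
    (Omega : measurableType d) (P : probability Omega R) (p : int -> R)
    (C : nat -> Omega -> int * int) : Prop :=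
  markov_chain P (anisotropic_transition p) C.

Definition started_at (R : realType) (d : measure_display)
    (Omega : measurableType d) (P : probability Omega R) (S : Type)
    (X : nat -> Omega -> S) (s : S) : Prop :=
  P [set w | X 0%N w = s] = 1%E.

Definition transient (R : realType) (d : measure_display)
    (Omega : measurableType d) (P : probability Omega R)
    (C : nat -> Omega -> int * int) : Prop :=
  {ae P, forall w, finite_set [set N | (0 < N)%N /\ C N w = (0, 0)]}.

(* The integers -k <= j <= k are enumerated as j = i - k with 0 <= i <= 2k. *)
Definition symmetric_sum (R : realType) (f : int -> R) (k : nat) : R :=
  \sum_(0 <= i < (2 * k).+1) f (i%:Z - k%:Z).

(* Main.v *)
(** The walk is reversible for the measure giving (k, j) mass 1 / p_j: it is the
    network on Z^2 with unit vertical conductances and horizontal conductances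
    a_j = 1 / (2 p_j) - 1 on row j. Let u = sum_(n < N) P(C_n = .) p, the Green
    function up to time N divided by the reversing measure. Summing
    u * (laplacian u) by parts gives Dirichlet energy D(u) <= u(0, 0), so a
    bound u(0, 0)^2 <= K D(u) with K independent of N bounds the expected number
    of returns, and Borel-Cantelli concludes.

    For this bound, compare the averages of u over the segments [0, w) and
    [0, w') of row 0 by moving vertically to rows |j| <= h, where the comparison
    is horizontal, and averaging over j with weights a_j: the squared difference
    is at most a constant times (h / w + w' / S_h) D(u), where
    S_h = sum_(|j| <= h) a_j is of order h^(1 + A). Choosing b with b^A >= 16,
    w_n = (4b)^n and h_n = B b^n makes both ratios O(4^-n), so the differences
    are summable, while the averages tend to 0 as u has finite support. *)

Require Import Defs.
From HB Require Import structures.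
From mathcomp Require Import all_boot all_order all_algebra.
From mathcomp Require Import all_classical all_reals all_analysis.
From mathcomp Require Import zify ring lra.
Import Order.TTheory GRing.Theory Num.Theory.
Import numFieldNormedType.Exports.
Local Open Scope classical_set_scope.
Local Open Scope ring_scope.

(** * Cauchy-Schwarz for finite sums *)

Lemma sqr_sum_le (R : realType) (f : nat -> R) (n : nat) :
  (\sum_(0 <= i < n) f i) ^+ 2 <= n%:R * \sum_(0 <= i < n) f i ^+ 2.
Proof.
elim: n => [|n IHn]; first by rewrite !big_nil expr0n /= mulr0.
rewrite !big_nat_recr //= -[in leRHS]natr1.
have cross : 2 * f n * \sum_(0 <= i < n) f i <=
    n%:R * f n ^+ 2 + \sum_(0 <= i < n) f i ^+ 2.
  have -> : n%:R * f n ^+ 2 = \sum_(0 <= i < n) f n ^+ 2.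
    by rewrite sumr_const_nat subn0 mulr_natl.
  rewrite mulr_sumr -big_split /=.
  by apply: ler_sum => i _; have := sqr_ge0 (f n - f i); nra.
nra.
Qed.

(** Cauchy-Schwarz along the path between i and j, which has at most n edges; the sum is then
    enlarged to all n edges. *)
Lemma sqr_sub_le_sum (R : realType) (g : nat -> R) (n i j : nat) :
  (i <= n)%N -> (j <= n)%N ->
  (g i - g j) ^+ 2 <= n%:R * \sum_(0 <= l < n) (g l.+1 - g l) ^+ 2.
Proof.
wlog le_ji : i j / (j <= i)%N.
  move=> H; have [ji|ij] := leqP j i; first exact: H.
  move=> i_n j_n; rewrite -sqrrN opprB; apply: H => //; exact: ltnW.
move=> i_n j_n; rewrite -(telescope_sumr g le_ji).
apply: le_trans (_ : n%:R * \sum_(j <= l < i) (g l.+1 - g l) ^+ 2 <= _).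
  have shift (h : nat -> R) :
      \sum_(j <= l < i) h l = \sum_(0 <= l < i - j) h (l + j)%N.
    by rewrite -{1}[j]add0n big_addn.
  rewrite !shift; apply: le_trans (sqr_sum_le _ _ _) _.
  apply: ler_wpM2r; first by apply: sumr_ge0 => k _; exact: sqr_ge0.
  by rewrite ler_nat; apply: leq_trans i_n; exact: leq_subr.
apply: ler_wpM2l; first exact: ler0n.
rewrite (big_cat_nat (leq0n j) j_n) /= (big_cat_nat le_ji i_n) /= addrC.
have pos a b : 0 <= \sum_(a <= l < b) (g l.+1 - g l) ^+ 2.
  by apply: sumr_ge0 => k _; exact: sqr_ge0.
by rewrite -addrA lerDl addr_ge0.
Qed.

(** Jensen for the square: the deviation of the average is the average of the deviations. *)
Lemma sqr_avg_sub_le (R : realType) (f : nat -> R) (w : nat) (x B : R) :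
  (0 < w)%N -> (\sum_(0 <= k < w) (f k - x) ^+ 2) <= w%:R * B ->
  ((\sum_(0 <= k < w) f k) / w%:R - x) ^+ 2 <= B.
Proof.
move=> w0 hB; have w0' : 0 < w%:R :> R by rewrite ltr0n.
have -> : (\sum_(0 <= k < w) f k) / w%:R - x
    = (\sum_(0 <= k < w) (f k - x)) / w%:R.
  rewrite big_split /= sumr_const_nat subn0 mulrDl -(mulr_natr (- x)) mulfK //.
  by rewrite gt_eqF.
rewrite expr_div_n ler_pdivrMr ?exprn_gt0 //.
apply: le_trans (sqr_sum_le _ _ _) _; rewrite expr2 mulrCA.
by rewrite ler_wpM2l ?ler0n// mulrC.
Qed.

(** * Sums over symmetric intervals *)

Lemma symmetric_sumS (R : realType) (f : int -> R) (M : nat) :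
  symmetric_sum f M.+1 = symmetric_sum f M + f M.+1%:Z + f (- M.+1%:Z).
Proof.
rewrite /symmetric_sum mulnS addnC addn2 big_nat_recl // big_nat_recr //=.
rewrite sub0r [LHS]addrC; congr (_ + _ + _); last first.
  by congr f; lia.
by apply: eq_bigr => i _; congr f; lia.
Qed.

Lemma symmetric_sum0 (R : realType) (f : int -> R) : symmetric_sum f 0 = f 0.
Proof. by rewrite /symmetric_sum muln0 big_nat1. Qed.

Lemma symmetric_sum_ge0 (R : realType) (f : int -> R) (M : nat) :
  (forall j, 0 <= f j) -> 0 <= symmetric_sum f M.
Proof. by move=> f0; apply: sumr_ge0. Qed.

Lemma le_symmetric_sum (R : realType) (f g : int -> R) (M : nat) :
  (forall j, `|j| <= M%:Z -> f j <= g j) -> symmetric_sum f M <= symmetric_sum g M.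
Proof.
by move=> fg; apply: ler_sum_nat => i /andP[_ iM]; apply: fg; lia.
Qed.

Lemma eq_symmetric_sum (R : realType) (f g : int -> R) (M : nat) :
  (forall j, `|j| <= M%:Z -> f j = g j) -> symmetric_sum f M = symmetric_sum g M.
Proof.
by move=> fg; apply: eq_big_nat => i /andP[_ iM]; apply: fg; lia.
Qed.

Lemma symmetric_sum_mono (R : realType) (f : int -> R) (h M : nat) :
  (forall j, 0 <= f j) -> (h <= M)%N -> symmetric_sum f h <= symmetric_sum f M.
Proof.
move=> f0; elim: M => [|M IHM]; first by rewrite leqn0 => /eqP ->.
rewrite leq_eqVlt => /predU1P[-> //|]; rewrite ltnS => /IHM le_hM.
apply: le_trans le_hM _; rewrite symmetric_sumS -addrA lerDl.
by rewrite addr_ge0.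
Qed.

Lemma sum_nat_le_symmetric (R : realType) (f : int -> R) (w M : nat) :
  (forall j, 0 <= f j) -> (w <= M.+1)%N ->
  \sum_(0 <= k < w) f k%:Z <= symmetric_sum f M.
Proof.
move=> f0; case: w => [_|w]; first by rewrite big_nil symmetric_sum_ge0.
rewrite ltnS => le_wM; apply: le_trans _ (symmetric_sum_mono _ _ _ _ f0 le_wM).
elim: w {le_wM} => [|w IHw]; first by rewrite big_nat1 symmetric_sum0.
by rewrite big_nat_recr //= symmetric_sumS -addrA lerD// lerDl.
Qed.

Lemma sqr_norm_sub_le (R : realType) (g : int -> R) (h : nat) (j : int) :
  `|j| <= h%:Z ->
  (g j - g 0) ^+ 2
    <= (2 * h).+1%:R * symmetric_sum (fun i => (g (i + 1) - g i) ^+ 2) h.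
Proof.
(* Shifting by h turns [-h, h + 1] into [0, 2h + 1]; the point 0 becomes the index h. *)
move=> jh; have := @sqr_sub_le_sum R (fun i => g (i%:Z - h%:Z)) (2 * h).+1
  (absz (j + h%:Z)) h.
rewrite subrr (_ : (absz (j + h%:Z))%:Z - h%:Z = j); last lia.
have -> : symmetric_sum (fun i => (g (i + 1) - g i) ^+ 2) h = 
  \sum_(0 <= l < (2 * h).+1) (g (l.+1%:Z - h%:Z) - g (l%:Z - h%:Z)) ^+ 2.
  by apply: eq_big_nat => i _; congr ((g _ - _) ^+ 2); lia.
by apply; lia.
Qed.

Lemma sqr_add4_le (R : realType) (x y z t : R) :
  (x + y + z + t) ^+ 2 <= 4 * (x ^+ 2 + y ^+ 2 + z ^+ 2 + t ^+ 2).
Proof.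
have := sqr_ge0 (x - y); have := sqr_ge0 (x - z); have := sqr_ge0 (x - t).
have := sqr_ge0 (y - z); have := sqr_ge0 (y - t); have := sqr_ge0 (z - t).
nra.
Qed.

(** * Comparison of averages over segments of rows *)

Definition row_avg {R : realType} (u : int -> int -> R) (w : nat) (j : int) : R :=
  (\sum_(0 <= k < w) u k%:Z j) / w%:R.

(** Each of the w columns carries a vertical path between rows 0 and j with at most 2h + 1 edges;
    averaging over the columns gains the factor 1 / w. *)
Lemma row_avg_vertical (R : realType) (u : int -> int -> R) (D : R)
    (w h : nat) (j : int) :
  (0 < w)%N -> `|j| <= h%:Z ->
  \sum_(0 <= k < w) symmetric_sum (fun i => (u k%:Z (i + 1) - u k%:Z i) ^+ 2) h
    <= D ->
  (row_avg u w j - row_avg u w 0) ^+ 2 <= (2 * h).+1%:R / w%:R * D.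
Proof.
move=> w0 jh hD; rewrite /row_avg -mulrBl -sumrB -[X in X ^+ 2]subr0.
apply: sqr_avg_sub_le => //.
have w0' : 0 < w%:R :> R by rewrite ltr0n.
have -> : w%:R * ((2 * h).+1%:R / w%:R * D) = (2 * h).+1%:R * D.
  by field; rewrite gt_eqF.
apply: le_trans (ler_wpM2l (ler0n _ _) hD).
rewrite mulr_sumr; apply: ler_sum => k _; rewrite subr0.
exact: (sqr_norm_sub_le R (u k%:Z)).
Qed.

(** Comparison with the single value [u 0 j] lets the averages of both lengths in a step be
    controlled by the same w' horizontal edges. *)
Lemma row_avg_horizontal (R : realType) (u : int -> int -> R)
    (w w' : nat) (j : int) :
  (0 < w <= w')%N ->
  (row_avg u w j - u 0 j) ^+ 2
    <= w'%:R * \sum_(0 <= k < w') (u (k%:Z + 1) j - u k%:Z j) ^+ 2.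
Proof.
move=> /andP[w0 ww']; apply: sqr_avg_sub_le => //.
rewrite -{2}(subn0 w) mulr_natl -sumr_const_nat.
apply: ler_sum_nat => k /andP[_ kw].
apply: le_trans (sqr_sub_le_sum R (fun i => u i%:Z j) w' k 0 _ _) _ => //.
  by apply: leq_trans ww'; exact: ltnW.
rewrite ler_wpM2l ?ler0n// ler_sum// => i _.
by rewrite (_ : i.+1%:Z = i%:Z + 1) //; lia.
Qed.

(** The two averages in row 0 are joined by a route through row j: vertically to row j, through
    [u 0 j], and vertically back. Weighting by [a j] and summing over j turns the horizontal cost
    into energy, while the vertical bound, uniform in j, picks up the factor [symmetric_sum a h]. *)
Lemma row_avg_step (R : realType) (a : int -> R) (u : int -> int -> R) (D : R)
    (w w' h : nat) :
  (forall j, 0 <= a j) -> (0 < w <= w')%N ->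
  symmetric_sum (fun j => a j *
    \sum_(0 <= k < w') (u (k%:Z + 1) j - u k%:Z j) ^+ 2) h <= D ->
  \sum_(0 <= k < w) symmetric_sum (fun i => (u k%:Z (i + 1) - u k%:Z i) ^+ 2) h
    <= D ->
  \sum_(0 <= k < w') symmetric_sum (fun i => (u k%:Z (i + 1) - u k%:Z i) ^+ 2) h
    <= D ->
  symmetric_sum a h * (row_avg u w' 0 - row_avg u w 0) ^+ 2 <=
  4 * (symmetric_sum a h * (2 * h).+1%:R * (w%:R^-1 + w'%:R^-1) + 2 * w'%:R) * D.
Proof.
move=> a0 ww' hE hV hV'; have /andP[w0 le_ww'] := ww'.
have w'0 := leq_trans w0 le_ww'.
pose V := (2 * h).+1%:R / w%:R * D + (2 * h).+1%:R / w'%:R * D.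
pose E j := \sum_(0 <= k < w') (u (k%:Z + 1) j - u k%:Z j) ^+ 2.
have key j : `|j| <= h%:Z -> a j * (row_avg u w' 0 - row_avg u w 0) ^+ 2 <=
    4 * V * a j + 8 * w'%:R * (a j * E j).
  move=> jh.
  have -> : 4 * V * a j + 8 * w'%:R * (a j * E j)
     = a j * (4 * (V + 2 * (w'%:R * E j))) by ring.
  apply: ler_wpM2l => //.
  have h1 := row_avg_vertical _ _ _ _ _ _ w0 jh hV.
  have h2 := row_avg_vertical _ _ _ _ _ _ w'0 jh hV'.
  have h3 := row_avg_horizontal _ u _ _ j ww'.
  have h4 : (row_avg u w' j - u 0 j) ^+ 2 <= w'%:R * E j.
    by apply: row_avg_horizontal; rewrite w'0 leqnn.
  have -> : row_avg u w' 0 - row_avg u w 0 =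
    - (row_avg u w' j - row_avg u w' 0) + (row_avg u w' j - u 0 j)
    + - (row_avg u w j - u 0 j) + (row_avg u w j - row_avg u w 0) by ring.
  apply: le_trans (sqr_add4_le _ _ _ _ _) _; rewrite !sqrrN -/(E j) in h3 *.
  rewrite /V; lra.
apply: le_trans (_ : symmetric_sum (fun j => a j *
    (row_avg u w' 0 - row_avg u w 0) ^+ 2) h <= _).
  by rewrite /symmetric_sum mulr_suml.
apply: le_trans (le_symmetric_sum _ _ _ _ key) _.
rewrite /symmetric_sum big_split /= -!mulr_sumr -!/(symmetric_sum _ h).
have -> : 4 * (symmetric_sum a h * (2 * h).+1%:R * (w%:R^-1 + w'%:R^-1) +
    2 * w'%:R) * D = 4 * V * symmetric_sum a h + 8 * w'%:R * D.
  by rewrite /V; ring.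
by rewrite lerD2l ler_wpM2l// mulr_ge0.
Qed.

(** * Summation by parts and the Dirichlet energy *)

(** The two summands differ by an increment of T(k) = f(k)^2 - f(k) f(k - 1), which vanishes at both
    ends k = -M and k = M + 1. *)
Lemma dirichlet_row (R : realType) (f : int -> R) (M : nat) :
  (forall k, M%:Z <= `|k| -> f k = 0) ->
  symmetric_sum (fun k => f k * (2 * f k - f (k - 1) - f (k + 1))) M
  = symmetric_sum (fun k => (f (k + 1) - f k) ^+ 2) M.
Proof.
move=> f0; apply/eqP; rewrite -subr_eq0 /symmetric_sum -sumrB.
pose T (i : nat) := let k := i%:Z - M%:Z in f k ^+ 2 - f k * f (k - 1).
rewrite (eq_bigr (fun i => - (T i.+1 - T i))) => [|i _]; last first.
  rewrite /T /= (_ : i.+1%:Z - M%:Z = i%:Z - M%:Z + 1); last lia.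
  by rewrite addrK; ring.
rewrite sumrN telescope_sumr // oppr_eq0 /T /=.
rewrite (f0 ((2 * M).+1%:Z - M%:Z)); last lia.
by rewrite (f0 (0%:Z - M%:Z)) ?expr0n /= ?mul0r ?subrr//; lia.
Qed.

Lemma symmetric_sumD (R : realType) (f g : int -> R) (M : nat) :
  symmetric_sum (fun j => f j + g j) M = symmetric_sum f M + symmetric_sum g M.
Proof. by rewrite /symmetric_sum big_split. Qed.

Lemma symmetric_sum_exchange (R : realType) (f : int -> int -> R) (M : nat) :
  symmetric_sum (fun j => symmetric_sum (fun k => f k j) M) M
  = symmetric_sum (fun k => symmetric_sum (f k) M) M.
Proof. by rewrite /symmetric_sum exchange_big. Qed.

(** The sign is chosen so that the quadratic form is the energy, hence nonnegative when [a] is. *)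
Definition laplacian {R : realType} (a : int -> R) (u : int -> int -> R)
    (k j : int) : R :=
  a j * (2 * u k j - u (k - 1) j - u (k + 1) j)
  + (2 * u k j - u k (j - 1) - u k (j + 1)).

Lemma green_identity (R : realType) (a : int -> R) (u : int -> int -> R) (M : nat) :
  (forall k j, M%:Z <= `|k| \/ M%:Z <= `|j| -> u k j = 0) ->
  symmetric_sum (fun j => symmetric_sum (fun k => u k j * laplacian a u k j) M) M
  = symmetric_sum (fun j => a j *
      symmetric_sum (fun k => (u (k + 1) j - u k j) ^+ 2) M) M
    + symmetric_sum (fun k =>
        symmetric_sum (fun j => (u k (j + 1) - u k j) ^+ 2) M) M.
Proof.
move=> u0.
have -> : symmetric_sum (fun k =>
    symmetric_sum (fun j => (u k (j + 1) - u k j) ^+ 2) M) M =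
  symmetric_sum (fun j => symmetric_sum (fun k =>
     u k j * (2 * u k j - u k (j - 1) - u k (j + 1))) M) M.
  rewrite (symmetric_sum_exchange _
    (fun k j => u k j * (2 * u k j - u k (j - 1) - u k (j + 1)))).
  apply: eq_symmetric_sum => k _; rewrite -dirichlet_row // => j jM.
  by apply: u0; right.
rewrite -symmetric_sumD; apply: eq_symmetric_sum => j _.
rewrite -(dirichlet_row _ (fun k => u k j)).
  rewrite /symmetric_sum mulr_sumr -big_split /=.
  by apply: eq_bigr => i _; rewrite /laplacian; ring.
by move=> k kM; apply: u0; left.
Qed.

(* Horizontal conductance in row j when vertical edges have conductance 1;
   rows with p_j = 1/2 have none. *)
Definition conductance {R : realType} (p : int -> R) (j : int) : R :=
  (2 * p j)^-1 - 1.

Lemma conductance_ge0 (R : realType) (p : int -> R) (j : int) :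
  0 < p j <= 2^-1 -> 0 <= conductance p j.
Proof.
move=> /andP[p0 p1]; rewrite subr_ge0 -[leLHS]invr1 lef_pV2 ?posrE; lra.
Qed.

(** * The Green function and its energy *)

(** Forward equation for the law of the walk. Together with nonnegativity, this is all that the
    analytic part uses about that law. *)
Definition walk_recursion {R : realType} (p : int -> R)
    (mu : nat -> int -> int -> R) : Prop :=
  (forall k j, mu 0%N k j = ((k, j) == (0, 0))%:R) /\
  (forall n k j, mu n.+1 k j =
    (2^-1 - p j) * (mu n (k - 1) j + mu n (k + 1) j)
    + p (j - 1) * mu n k (j - 1) + p (j + 1) * mu n k (j + 1)).

Lemma walk_support (R : realType) (p : int -> R) (mu : nat -> int -> int -> R)
    (n : nat) (k j : int) :
  walk_recursion p mu -> n%:Z < `|k| \/ n%:Z < `|j| -> mu n k j = 0.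
Proof.
move=> [mu0 muS]; elim: n k j => [|n IHn] k j kj.
  by rewrite mu0 xpair_eqE; case: eqP => //=; case: eqP => //=; lia.
rewrite muS !IHn ?addr0 ?mulr0 ?addr0//; lia.
Qed.

Definition green {R : realType} (p : int -> R) (mu : nat -> int -> int -> R)
    (N : nat) (k j : int) : R := p j * \sum_(0 <= n < N) mu n k j.

(** A vertex of row j has total conductance 2 (a_j + 1) = 1 / p_j, so the Laplacian of p mu_n is
    mu_n - mu_(n+1), and the sum over n telescopes. *)
Lemma laplacian_green (R : realType) (p : int -> R)
    (mu : nat -> int -> int -> R) (N : nat) (k j : int) :
  (forall j, 0 < p j) -> walk_recursion p mu ->
  laplacian (conductance p) (green p mu N) k j = mu 0%N k j - mu N k j.
Proof.
move=> p0 [mu0 muS]; elim: N => [|N IHN].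
  by rewrite /laplacian /green !big_nil !mulr0 !subr0 !mulr0 addr0 subrr.
rewrite /laplacian /green !big_nat_recr //= !mulrDr -!/(green p mu N _ _).
move: IHN; rewrite /laplacian => IHN.
transitivity (mu 0%N k j - mu N k j + (mu N k j - mu N.+1 k j)); last by ring.
rewrite -IHN muS /conductance; field.
by rewrite gt_eqF.
Qed.

Lemma symmetric_sum_origin (R : realType) (f : int -> R) (M : nat) :
  (forall j, j != 0 -> f j = 0) -> symmetric_sum f M = f 0.
Proof.
move=> f0; elim: M => [|M IHM]; first exact: symmetric_sum0.
by rewrite symmetric_sumS IHM (f0 M.+1%:Z) // (f0 (- M.+1%:Z)) ?addr0.
Qed.

(** The Green identity pairs u with mu_0 - mu_N. The mu_N part is dropped by its sign, and mu_0 is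
    the unit mass at the origin. *)
Lemma green_energy_le (R : realType) (p : int -> R)
    (mu : nat -> int -> int -> R) (N M : nat) :
  (forall j, 0 < p j) -> walk_recursion p mu -> (forall n k j, 0 <= mu n k j) ->
  (N < M)%N ->
  symmetric_sum (fun j => conductance p j * symmetric_sum (fun k =>
      (green p mu N (k + 1) j - green p mu N k j) ^+ 2) M) M
    + symmetric_sum (fun k => symmetric_sum (fun j =>
      (green p mu N k (j + 1) - green p mu N k j) ^+ 2) M) M
  <= green p mu N 0 0.
Proof.
move=> p0 rec mu_ge0 NM; rewrite -green_identity; last first.
  move=> k j kj; rewrite /green big_nat big1 ?mulr0// => n /andP[_ nN].
  by apply: (walk_support _ p) => //; lia.
have green_ge0 k j : 0 <= green p mu N k j.
  by rewrite mulr_ge0 ?sumr_ge0// ltW.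
have [mu0 _] := rec.
rewrite [leRHS](_ : _ = symmetric_sum (fun j =>
    symmetric_sum (fun k => green p mu N k j * mu 0%N k j) M) M).
  do 2!apply: le_symmetric_sum => ? _.
  by rewrite laplacian_green// ler_wpM2l// lerBlDr lerDl.
rewrite symmetric_sum_origin => [|j j0].
  rewrite symmetric_sum_origin ?mu0 ?mulr1// => k k0.
  by rewrite mu0 xpair_eqE (negbTE k0) mulr0.
rewrite /symmetric_sum big1// => i _.
by rewrite mu0 xpair_eqE (negbTE j0) andbF mulr0.
Qed.

(** * Summation over geometric scales *)

Lemma ler_of_geometric_error (R : realType) (x y V : R) :
  (forall n : nat, x <= y + V / 2 ^+ n) -> x <= y.
Proof.
move=> H; rewrite leNgt; apply/negP => xy.
have d0 : 0 < x - y by rewrite subr_gt0.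
(* Here 2^(n+1) > n + 1 > |V| / (x - y). *)
pose n := Num.trunc (`|V| / (x - y)).
have := H n.+1; apply/negP; rewrite -ltNge -ltrBrDl.
rewrite ltr_pdivrMr ?exprn_gt0//; apply: le_lt_trans (ler_norm V) _.
rewrite mulrC -ltr_pdivrMr//; apply: lt_le_trans (truncnS_gt _) _ => //.
by rewrite -natrX ler_nat ltnW// ltn_expl.
Qed.

(** Widths grow by 4b, heights by b and row weights by 16b per scale, so both error ratios shrink by
    4; the square root leaves 2^-n. *)
Lemma row_avg_geometric_step (R : realType) (a : int -> R)
    (u : int -> int -> R) (D c : R) (B b n : nat) :
  (forall j, 0 <= a j) ->
  (forall w h, symmetric_sum (fun j => a j *
     \sum_(0 <= k < w) (u (k%:Z + 1) j - u k%:Z j) ^+ 2) h <= D) ->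
  (forall w h, \sum_(0 <= k < w)
     symmetric_sum (fun i => (u k%:Z (i + 1) - u k%:Z i) ^+ 2) h <= D) ->
  (0 < B)%N -> (0 < b)%N -> 0 < c ->
  c * (16 * b)%:R ^+ n <= symmetric_sum a (B * b ^ n) ->
  `|row_avg u ((4 * b) ^ n.+1) 0 - row_avg u ((4 * b) ^ n) 0|
    <= Num.sqrt ((24 * B%:R + 32 * b%:R / c) * D) / 2 ^+ n.
Proof.
move=> a0 hE hV B0 b0 c0.
set h := (B * b ^ n)%N; set w' := ((4 * b) ^ n.+1)%N; set w := ((4 * b) ^ n)%N.
set S := symmetric_sum a h => hS.
have D0 : 0 <= D by have := hV 0%N 0%N; rewrite big_nil.
have w0 : (0 < w)%N by rewrite expn_gt0 muln_gt0 b0.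
have ww' : (w <= w')%N by rewrite leq_pexp2l// muln_gt0 b0.
have step := row_avg_step _ _ _ _ _ _ h a0 (_ : (0 < w <= w')%N) (hE w' h)
  (hV w h) (hV w' h).
rewrite w0 ww' in step; have {step} := step isT.
rewrite -/S; set d := _ - _.
(* In these terms w = q^2 x, h = B x and S >= c q^4 x. *)
pose x : R := b%:R ^+ n; pose q : R := 2 ^+ n.
have x0 : 0 < x by rewrite exprn_gt0// ltr0n.
have q0 : 0 < q by rewrite exprn_gt0.
have b0' : 1 <= b%:R :> R by rewrite ler1n.
have B0' : 1 <= B%:R :> R by rewrite ler1n.
have x1 : 1 <= x by rewrite exprn_ege1.
have wE : w%:R = q ^+ 2 * x :> R.
  by rewrite /w natrX natrM exprMn /q -exprM mulnC exprM -natrX.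
have w'E : w'%:R = 4 * b%:R * (q ^+ 2 * x) :> R.
  by rewrite -wE /w' expnS natrM natrM.
have hE' : (2 * h).+1%:R <= 3 * B%:R * x :> R.
  have -> : (2 * h).+1%:R = 1 + 2 * (B%:R * x) :> R.
    by rewrite -natr1 addrC natrM /h natrM natrX.
  have := mulr_ege1 B0' x1; lra.
have SE : c * (q ^+ 4 * x) <= S.
  apply: le_trans hS; rewrite natrM exprMn -/x /q -exprM mulnC exprM.
  by rewrite (_ : 16%:R = 2 ^+ 4 :> R)// -natrX.
have S0 : 0 < S by apply: lt_le_trans SE; rewrite !mulr_gt0// exprn_gt0.
have inv : w%:R^-1 + w'%:R^-1 <= 2 / (q ^+ 2 * x).
  rewrite wE mulr2n mulrDl mul1r lerD2l lef_pV2 ?posrE; last 2 first.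
  - by rewrite ltr0n (leq_trans w0).
  - by rewrite mulr_gt0// exprn_gt0.
  by rewrite -wE ler_nat.
move=> step.
have bound : S * d ^+ 2 <= S * ((24 * B%:R + 32 * b%:R / c) * D / q ^+ 2).
  apply: le_trans step _.
  (* The constants are 24 = 4 * 3 * 2, from 2h + 1 <= 3 B x and 1/w + 1/w' <= 2/w, and 32 = 4 * 2 *
     4, from w' = 4 b w. *)
  have -> : S * ((24 * B%:R + 32 * b%:R / c) * D / q ^+ 2)
     = 4 * (S * (3 * B%:R * x) * (2 / (q ^+ 2 * x))
            + 2 * (4 * b%:R * (S / (c * q ^+ 2)))) * D.
    by field; rewrite !gt_eqF.
  apply: ler_wpM2r => //; apply: ler_wpM2l => //; apply: lerD.
    apply: ler_pM => //.
    - by rewrite mulr_ge0// ltW.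
    - by rewrite ler_wpM2l// ltW.
  rewrite w'E; apply: ler_wpM2l => //; apply: ler_wpM2l => //.
  rewrite ler_pdivlMr ?mulr_gt0 ?exprn_gt0//; apply: le_trans SE.
  by rewrite le_eqVlt; apply/orP; left; apply/eqP; ring.
move: bound; rewrite ler_pM2l// => bound.
rewrite -sqrtr_sqr; apply: le_trans (ler_wsqrtr bound) _.
have kD0 : 0 <= (24 * B%:R + 32 * b%:R / c) * D.
  by rewrite mulr_ge0// addr_ge0 ?divr_ge0 ?mulr_ge0// ltW.
by rewrite sqrtrM// sqrtrV ?exprn_ge0 ?(ltW q0)// sqrtr_sqr ger0_norm ?(ltW q0).
Qed.

(** The average at scale 0 is [u 0 0] itself, and the later ones tend to 0. The bound [V] may depend
    on [u], since it disappears in the limit. *)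
Lemma poincare_origin (R : realType) (a : int -> R) (u : int -> int -> R)
    (D V c : R) (B b : nat) :
  (forall j, 0 <= a j) ->
  (forall w h, symmetric_sum (fun j => a j *
     \sum_(0 <= k < w) (u (k%:Z + 1) j - u k%:Z j) ^+ 2) h <= D) ->
  (forall w h, \sum_(0 <= k < w)
     symmetric_sum (fun i => (u k%:Z (i + 1) - u k%:Z i) ^+ 2) h <= D) ->
  (forall w, \sum_(0 <= k < w) u k%:Z 0 <= V) ->
  (0 < B)%N -> (0 < b)%N -> 0 < c ->
  (forall n, c * (16 * b)%:R ^+ n <= symmetric_sum a (B * b ^ n)) ->
  u 0 0 <= 2 * Num.sqrt ((24 * B%:R + 32 * b%:R / c) * D).
Proof.
move=> a0 hE hV hu B0 b0 c0 hS.
set s := Num.sqrt _; pose A n := row_avg u ((4 * b) ^ n) 0.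
have step n : `|A n.+1 - A n| <= s / 2 ^+ n by exact: row_avg_geometric_step.
(* Partial sums of the geometric series with terms s / 2^n. *)
have sumA n : u 0 0 - A n <= 2 * s * (1 - (2 ^+ n)^-1).
  elim: n => [|n IHn].
    by rewrite /A expn0 /row_avg big_nat1 divr1 subrr expr0 invr1 subrr mulr0.
  have := step n; rewrite ler_norml => /andP[h _].
  have -> : u 0 0 - A n.+1 = u 0 0 - A n - (A n.+1 - A n) by ring.
  have -> : 2 * s * (1 - (2 ^+ n.+1)^-1)
    = 2 * s * (1 - (2 ^+ n)^-1) + s / 2 ^+ n.
    by rewrite exprS; field; rewrite expf_neq0.
  by apply: lerD => //; rewrite lerNl.
have s0 : 0 <= s by exact: sqrtr_ge0.
have V0 : 0 <= V by have := hu 0%N; rewrite big_nil.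
apply: (@ler_of_geometric_error _ _ _ V) => n.
have p0 : 0 < 2 ^+ n :> R by rewrite exprn_gt0.
have An : A n <= V / 2 ^+ n.
  apply: le_trans (ler_wpM2r _ (hu _)) _; first by rewrite invr_ge0.
  rewrite ler_wpM2l// lef_pV2 ?posrE ?ltr0n ?expn_gt0 ?muln_gt0 ?b0//.
  by rewrite natrX lerXn2r ?nnegrE//= ler_nat; lia.
have : 2 * s * (1 - (2 ^+ n)^-1) <= 2 * s.
  by rewrite ler_piMr ?mulr_ge0// lerBlDr lerDl invr_ge0 ltW.
have := sumA n; lra.
Qed.

(** The energy bound allows D = u(0, 0) in [poincare_origin]; the resulting inequality u(0, 0) <= 2
    sqrt(kappa u(0, 0)) is self-improving and gives a bound free of N. *)
Lemma green_bounded (R : realType) (p : int -> R)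
    (mu : nat -> int -> int -> R) (c : R) (B b N : nat) :
  (forall j, 0 < p j <= 2^-1) -> walk_recursion p mu ->
  (forall n k j, 0 <= mu n k j) ->
  (0 < B)%N -> (0 < b)%N -> 0 < c ->
  (forall n, c * (16 * b)%:R ^+ n <= symmetric_sum (conductance p) (B * b ^ n)) ->
  green p mu N 0 0 <= 4 * (24 * B%:R + 32 * b%:R / c).
Proof.
move=> hp rec mu0 B0 b0 c0 hS.
have p0 j : 0 < p j by case/andP: (hp j).
have a0 j := conductance_ge0 _ _ _ (hp j).
set u := green p mu N; set kappa := _ + _.
have kappa0 : 0 <= kappa by rewrite addr_ge0 ?divr_ge0 ?mulr_ge0// ltW.
have u0 k j : 0 <= u k j by rewrite mulr_ge0 ?sumr_ge0// ltW.
have energy M := green_energy_le _ _ _ _ M p0 rec mu0.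
have hE w h : symmetric_sum (fun j => conductance p j *
    \sum_(0 <= k < w) (u (k%:Z + 1) j - u k%:Z j) ^+ 2) h <= u 0 0.
  (* The box must contain the given rectangle and, for the energy bound, exceed N. *)
  pose M := (maxn w (maxn h N.+1)).
  apply: le_trans (energy N M _); last by rewrite /M; lia.
  rewrite -[leLHS]addr0; apply: lerD; last first.
    by do 2!apply: symmetric_sum_ge0 => ?; exact: sqr_ge0.
  apply: le_trans (symmetric_sum_mono _ _ h M _ _) _ => [j||].
  - by rewrite mulr_ge0 ?sumr_ge0// => k _; exact: sqr_ge0.
  - by rewrite /M; lia.
  apply: le_symmetric_sum => j _; apply: ler_wpM2l => //.
  apply: (sum_nat_le_symmetric _ (fun k => (u (k + 1) j - u k j) ^+ 2)).
    by move=> k; exact: sqr_ge0.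
  by rewrite /M; lia.
have hV w h : \sum_(0 <= k < w)
    symmetric_sum (fun i => (u k%:Z (i + 1) - u k%:Z i) ^+ 2) h <= u 0 0.
  pose M := (maxn w (maxn h N.+1)).
  apply: le_trans (energy N M _); last by rewrite /M; lia.
  rewrite -[leLHS]add0r; apply: lerD.
    apply: symmetric_sum_ge0 => j; rewrite mulr_ge0 ?symmetric_sum_ge0// => k.
    exact: sqr_ge0.
  apply: le_trans (_ : \sum_(0 <= k < w)
    symmetric_sum (fun i => (u k%:Z (i + 1) - u k%:Z i) ^+ 2) M <= _).
    apply: ler_sum => k _; apply: symmetric_sum_mono; last by rewrite /M; lia.
    by move=> j; exact: sqr_ge0.
  apply: (sum_nat_le_symmetric _ (fun k =>
    symmetric_sum (fun j => (u k (j + 1) - u k j) ^+ 2) M)).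
    by move=> k; apply: symmetric_sum_ge0 => j; exact: sqr_ge0.
  by rewrite /M; lia.
(* Since u vanishes beyond distance N, one row sum bounds all segment sums. *)
have hu w : \sum_(0 <= k < w) u k%:Z 0 <= symmetric_sum (fun k => u k 0) N.
  apply: le_trans (sum_nat_le_symmetric _ (fun k => u k 0) w (maxn w N) _ _) _ => //.
    by lia.
  have : (N <= maxn w N)%N by lia.
  elim: (maxn w N) => [|M IHM]; first by rewrite leqn0 => /eqP ->.
  rewrite leq_eqVlt => /predU1P[-> //|]; rewrite ltnS => NM.
  rewrite symmetric_sumS -addrA.
  have z k : `|k| = M.+1%:Z -> u k 0 = 0.
    move=> kM; rewrite /u /green big_nat big1 ?mulr0// => n nN.
    by apply: (walk_support _ p) => //; lia.
  by rewrite !z ?addr0 ?IHM//; lia.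
have := poincare_origin _ _ _ _ _ _ _ _ a0 hE hV hu B0 b0 c0 hS.
rewrite -/kappa => le_u.
have sq : u 0 0 ^+ 2 <= 4 * kappa * u 0 0.
  apply: le_trans (_ : (2 * Num.sqrt (kappa * u 0 0)) ^+ 2 <= _).
    by rewrite lerXn2r ?nnegrE// mulr_ge0 ?sqrtr_ge0.
  rewrite exprMn sqr_sqrtr; last exact: mulr_ge0 kappa0 (u0 0 0).
  lra.
have [->|u_neq0] := eqVneq (u 0 0) 0; first by rewrite mulr_ge0.
by move: sq; rewrite expr2 ler_pM2r// lt_def u_neq0 u0.
Qed.

(** * Growth of the conductances *)

Lemma powR_nat_unbounded (R : realType) (e V : R) : 0 < e ->
  exists k0 : nat, forall k, (k0 <= k)%N -> V <= k%:R `^ e.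
Proof.
move=> e0; exists (Num.trunc (`|V| `^ e^-1)).+1 => k k0k.
apply: le_trans (ler_norm V) _.
have -> : `|V| = (`|V| `^ e^-1) `^ e by rewrite -powRrM mulVf ?gt_eqF// powRr1.
apply: ge0_ler_powR; rewrite ?nnegrE ?powR_ge0 ?ler0n//; first exact: ltW.
by apply/ltW; apply: lt_le_trans (truncnS_gt _) _; rewrite ler_nat.
Qed.

(** The sum of the conductances is half the sum of the 1 / p_j minus 2k + 1. Since A and delta are
    positive, the main term (c / 2) k^(1+A) dominates both the error and the linear term. *)
Lemma conductance_growth (R : realType) (p : int -> R) (c A delta : R) :
  0 < c -> 0 < A -> 0 < delta ->
  symmetric_sum (fun j => (p j)^-1)%R
    = (fun k : nat => c * k%:R `^ (1 + A))%R
      +O_\oo (fun k : nat => k%:R `^ (1 + A - delta))%R ->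
  exists (B b : nat) (c' : R), [/\ (0 < B)%N, (0 < b)%N, 0 < c' &
    forall n, c' * (16 * b)%:R ^+ n <= symmetric_sum (conductance p) (B * b ^ n)].
Proof.
move=> c0 A0 d0 /eqaddOP/bigO_exP[/= K [K0 [k1 _ hK]]].
(* The thresholds make the halved error and the linear term each at most (c / 8) k^(1+A), which
   leaves c / 2 - c / 8 - c / 8 = c / 4. *)
have [b hb] := @powR_nat_unbounded R A 16 A0.
have [k2 hk2] := @powR_nat_unbounded R A (24 / c) A0.
have [k3 hk3] := @powR_nat_unbounded R delta (4 * K / c) d0.
have lower k : (k1 <= k)%N -> (k2 <= k)%N -> (k3 <= k)%N -> (0 < k)%N ->
    c / 4 * (k%:R * k%:R `^ A) <= symmetric_sum (conductance p) k.
  move=> kk1 kk2 kk3 k0; have := hK k kk1.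
  have k0' : 0 < k%:R :> R by rewrite ltr0n.
  have := hk2 k kk2; have := hk3 k kk3.
  rewrite /= !fctE (ger0_norm (powR_ge0 _ _)).
  set S := symmetric_sum _ k.
  have -> : symmetric_sum (conductance p) k = S / 2 - (2 * k).+1%:R.
    have -> : (2 * k).+1%:R = \sum_(0 <= i < (2 * k).+1) 1 :> R.
      by rewrite sumr_const_nat subn0.
    rewrite /S /symmetric_sum mulr_suml -sumrB.
    by apply: eq_bigr => i _; rewrite /conductance invfM mulrC.
  rewrite powRD; last by rewrite (gt_eqF k0') implybT.
  rewrite powRr1; last exact: ltW.
  rewrite powRD; last by rewrite (gt_eqF k0') implybT.
  rewrite powRD; last by rewrite (gt_eqF k0') implybT.
  rewrite powRr1; last exact: ltW.
  rewrite powRN; set x := k%:R `^ A; set y := k%:R `^ delta => hy hx hS.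
  have y0 : 0 < y by exact: powR_gt0.
  have x0 : 0 < x by exact: powR_gt0.
  have e1 : K * (k%:R * x / y) <= c / 4 * (k%:R * x).
    rewrite (_ : K * _ = K / y * (k%:R * x)); last by ring.
    rewrite ler_wpM2r ?(mulr_ge0 (ltW k0') (ltW x0))// ler_pdivrMr//.
    by move: hy; rewrite ler_pdivrMr//; lra.
  have e2 : 3 * k%:R <= c / 8 * (k%:R * x).
    rewrite mulrCA mulrC ler_pM2l//; move: hx; rewrite ler_pdivrMr//; lra.
  have e3 : (2 * k).+1%:R <= 3 * k%:R :> R by rewrite -natrM ler_nat; lia.
  move: hS; rewrite ler_norml => /andP[hS _]; lra.
(* With B above every threshold, the lower bound holds at all heights B b^n; the successor of [b] is
   taken to have a positive base. *)
pose B := (maxn k1 (maxn k2 k3)).+1.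
exists B, b.+1, (c / 4); split => //; first by rewrite divr_gt0.
move=> n; have bn0 : (0 < b.+1 ^ n)%N by rewrite expn_gt0.
have le_BB : (B <= B * b.+1 ^ n)%N by rewrite leq_pmulr.
have low : c / 4 * ((B * b.+1 ^ n)%:R * (B * b.+1 ^ n)%:R `^ A) <=
    symmetric_sum (conductance p) (B * b.+1 ^ n).
  by move: (B * b.+1 ^ n)%N le_BB => m; rewrite /B => le_Bm; apply: lower; lia.
apply: le_trans low.
rewrite ler_wpM2l ?(divr_ge0 (ltW c0))// mulnC natrM exprMn.
have le_b : (b.+1 ^ n <= B * b.+1 ^ n)%N by rewrite leq_pmull.
apply: ler_pM => //; first by rewrite -natrX ler_nat.
apply: le_trans (_ : (b.+1 ^ n)%:R `^ A <= _); last first.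
  by apply: ge0_ler_powR; rewrite ?nnegrE ?ler0n ?(ltW A0) ?ler_nat.
rewrite natrX -powR_mulrn ?ler0n// -powRrM mulrC powRrM powR_mulrn ?powR_ge0//.
by rewrite lerXn2r ?nnegrE ?powR_ge0 ?ler0n// hb.
Qed.

(** * Markov chains on a countable state space *)

(** Coding states by naturals lets sums over states be series over [nat]; an index that codes no
    state has an empty fiber. *)
Lemma pickle_fiber (Omega : Type) (S : countType) (X : Omega -> S) (i : nat) :
  [set w | pickle (X w) = i] =
  if pickle_inv i is Some s then [set w | X w = s] else set0.
Proof.
apply/seteqP; split=> w /=; first by move=> <-; rewrite pickleK_inv.
have := @pickle_invK S i; case: (pickle_inv i) => //= s <- wE.
by congr pickle.
Qed.

Lemma measurable_pickle_fiber (d : measure_display) (Omega : measurableType d)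
    (S : countType) (X : Omega -> S) (i : nat) :
  (forall s, measurable [set w | X w = s]) ->
  measurable [set w | pickle (X w) = i].
Proof. by move=> mX; rewrite pickle_fiber; case: pickle_inv. Qed.

Lemma measure_countable_fibers (R : realType) (d : measure_display)
    (Omega : measurableType d) (P : probability Omega R) (S : countType)
    (X : Omega -> S) (F : set Omega) :
  (forall s, measurable [set w | X w = s]) -> measurable F ->
  P F = (\sum_(i <oo) P (F `&` [set w | pickle (X w) = i]))%E.
Proof.
move=> mX mF; rewrite -measure_semi_bigcup.
- rewrite -setI_bigcupr; congr (P _); apply/seteqP; split=> [w Fw|w []//].
  by split=> //; exists (pickle (X w)).
- by move=> i; apply: measurableI => //; exact: measurable_pickle_fiber.
- by apply/trivIsetP => i j _ _ ij; apply/seteqP; split=> w //= [[_ wi] [_ wj]];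
    move: ij; rewrite -wi -wj eqxx.
- apply: bigcupT_measurable => i; apply: measurableI => //.
  exact: measurable_pickle_fiber.
Qed.

(** Interpolates between the full history (m = 0) and the present state alone (m = N). *)
Definition window {Omega S : Type} (X : nat -> Omega -> S) (x : nat -> S)
    (m N : nat) : set Omega :=
  [set w | forall l, (m <= l <= N)%N -> X l w = x l].

Lemma measurable_window (d : measure_display) (Omega : measurableType d)
    (S : Type) (X : nat -> Omega -> S) (x : nat -> S) (m N : nat) :
  (forall n s, measurable [set w | X n w = s]) -> measurable (window X x m N).
Proof.
move=> mX.
rewrite (_ : window X x m N =
    \bigcap_(l in [set l | (m <= l <= N)%N]) [set w | X l w = x l]).
  by apply: bigcap_measurableType.
by apply/seteqP; split=> w /= H l; exact: H.
Qed.

(* The case m = 0 is the Markov property; the remaining steps forget the values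
   of the chain at times 0, .., m - 1 one at a time, by summing over them. *)
Lemma markov_window (R : realType) (d : measure_display)
    (Omega : measurableType d) (P : probability Omega R) (S : countType)
    (Q : S -> S -> R) (X : nat -> Omega -> S) (x : nat -> S) (s : S) (m N : nat) :
  markov_chain P Q X -> (m <= N)%N ->
  P (window X x m N `&` [set w | X N.+1 w = s])
    = ((Q (x N) s)%:E * P (window X x m N))%E.
Proof.
move=> [mX trans]; elim: m x => [|m IHm] x mN.
  have mH := measurable_window _ _ _ X x 0 N mX.
  have -> : window X x 0 N = history X x N.
    by apply/seteqP; split=> w /= H l; exact: H.
  (* On a null history the Markov property is silent, but both sides vanish. *)
  have [H0|H0] := eqVneq (P (history X x N)) 0%E.
    rewrite H0 mule0; apply/eqP; rewrite eq_le measure_ge0 andbT -[leRHS]H0.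
    have mH' : measurable (history X x N) by [].
    by apply: le_measure; rewrite ?inE//; exact: measurableI.
  have := trans N x s H0; rewrite /cond_prob => <-.
  have mH' : measurable (history X x N) by [].
  have f1 : P (history X x N) \is a fin_num by exact: fin_num_measure.
  rewrite setIC -[X in (_ * X)%E](fineK f1) -EFinM divfK; last first.
    by rewrite fine_eq0.
  by rewrite fineK// fin_num_measure//; exact: measurableI.
have mF := measurable_window _ _ _ X x m.+1 N mX.
rewrite (measure_countable_fibers _ _ _ P _ (X m) _ (mX m)); last first.
  by apply: measurableI.
rewrite (measure_countable_fibers _ _ _ P _ (X m) (window X x m.+1 N) (mX m))//.
rewrite -nneseriesZl; last by [].
apply: eq_eseriesr => i _; rewrite pickle_fiber.
case: pickle_inv => [t|]; last by rewrite !setI0 measure0 mule0.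
(* Prescribing the value t at time m gives a window that starts one step earlier; as m < N, the
   state at time N is unchanged. *)
pose y l := if l == m then t else x l.
have wE : window X x m.+1 N `&` [set w | X m w = t] = window X y m N.
  apply/seteqP; split=> w /=.
    move=> [H wt] l /andP[ml lN]; rewrite /y; case: eqP => [->//|lm].
    by apply: H; lia.
  move=> H; split=> [l ml|]; last by rewrite H ?/y ?eqxx//; lia.
  by rewrite H /y; [case: eqP => //; lia|lia].
rewrite setIAC wE IHm; last by lia.
by rewrite /y (_ : (N == m) = false)//; lia.
Qed.

Lemma markov_transition (R : realType) (d : measure_display)
    (Omega : measurableType d) (P : probability Omega R) (S : countType)
    (Q : S -> S -> R) (X : nat -> Omega -> S) (s t : S) (N : nat) :
  markov_chain P Q X ->
  P ([set w | X N.+1 w = t] `&` [set w | X N w = s])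
    = ((Q s t)%:E * P [set w | X N w = s])%E.
Proof.
move=> mc; have := markov_window _ _ _ _ _ _ _ (fun=> s) t N N mc (leqnn N).
have -> : window X (fun=> s) N N = [set w | X N w = s].
  apply/seteqP; split=> w /= H; first by apply: H; rewrite leqnn.
  by move=> l; rewrite -eqn_leq => /eqP <-.
by rewrite setIC.
Qed.

Lemma measurable_notin (d : measure_display) (Omega : measurableType d)
    (S : eqType) (X : Omega -> S) (l : seq S) :
  (forall s, measurable [set w | X w = s]) -> measurable [set w | X w \notin l].
Proof.
move=> mX; elim: l => [|s l IHl].
  by rewrite (_ : [set w | _] = setT)//; apply/seteqP; split.
rewrite (_ : [set w | _] = ~` [set w | X w = s] `&` [set w | X w \notin l]).
  by apply: measurableI => //; exact: measurableC.
apply/seteqP; split=> w /=; rewrite inE negb_or.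
  by move=> /andP[/eqP].
by move=> [/eqP -> ->].
Qed.

Lemma measure_fibers_seq (R : realType) (d : measure_display)
    (Omega : measurableType d) (P : probability Omega R) (S : countType)
    (X : Omega -> S) (F : set Omega) (l : seq S) :
  (forall s, measurable [set w | X w = s]) -> measurable F -> uniq l ->
  P F = (\sum_(s <- l) P (F `&` [set w | X w = s])
         + P (F `&` [set w | X w \notin l]))%E.
Proof.
move=> mX mF; elim: l => [_|s l IHl] /=.
  by rewrite big_nil add0e; congr (P _); apply/seteqP; split=> w //= [].
move=> /andP[sl ul]; rewrite IHl// big_cons [in RHS]addeAC -[RHS]addeC.
congr (_ + _)%E.
have mG : measurable (F `&` [set w | X w \notin l]).
  by apply: measurableI => //; exact: measurable_notin.
rewrite (measureDI P mG (mX s)) [LHS]addeC; congr (P _ + P _)%E.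
  apply/seteqP; split=> w /= [].
    by move=> [].
  by move=> Fw ws; split=> //; rewrite ws.
apply/seteqP; split=> w /=.
  move=> [[Fw wl] ws]; split=> //; rewrite inE negb_or wl andbT.
  by apply/eqP.
by rewrite inE negb_or => -[Fw /andP[/eqP ws wl]].
Qed.

(** The event of being outside [l] at time N splits into countably many fibers, from each of which t
    is reached with probability 0. *)
Lemma markov_forward (R : realType) (d : measure_display)
    (Omega : measurableType d) (P : probability Omega R) (S : countType)
    (Q : S -> S -> R) (X : nat -> Omega -> S) (t : S) (l : seq S) (N : nat) :
  markov_chain P Q X -> uniq l -> (forall s, s \notin l -> Q s t = 0) ->
  P [set w | X N.+1 w = t]
    = (\sum_(s <- l) (Q s t)%:E * P [set w | X N w = s])%E.
Proof.
move=> mc ul Ql; have [mX _] := mc.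
have mE : measurable ([set w | X N.+1 w = t] `&` [set w | X N w \notin l]).
  by apply: measurableI => //; exact: measurable_notin.
rewrite (measure_fibers_seq _ _ _ P _ (X N) _ l)//.
rewrite [X in (_ + X)%E](_ : _ = 0%E) ?adde0.
  by apply: eq_bigr => s _; exact: markov_transition.
rewrite (measure_countable_fibers _ _ _ P _ (X N))//.
apply: eseries0 => i _ _; rewrite pickle_fiber.
case: pickle_inv => [s|]; last by rewrite setI0 measure0.
have [sl|sl] := boolP (s \in l).
  rewrite (_ : _ `&` _ = set0) ?measure0//.
  by apply/seteqP; split=> w //= [[_ wl] ws]; rewrite ws sl in wl.
apply/eqP; rewrite eq_le measure_ge0 andbT.
apply: le_trans (_ : P ([set w | X N.+1 w = t] `&` [set w | X N w = s]) <= _)%E.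
  apply: le_measure; rewrite ?inE; try exact: measurableI.
  by move=> w /= [[]].
by rewrite (markov_transition _ _ _ _ _ _ _ _ _ _ mc) Ql// mul0e.
Qed.

(** * The law of the walk and the Borel-Cantelli argument *)

Lemma anisotropic_walk_recursion (R : realType) (d : measure_display)
    (Omega : measurableType d) (P : probability Omega R)
    (p : int -> R) (C : nat -> Omega -> int * int) :
  anisotropic_walk P p C -> started_at P C (0, 0) ->
  walk_recursion p (fun n k j => fine (P [set w | C n w = (k, j)])).
Proof.
move=> walk start; have [mC _] := walk; split=> [k j|n k j].
  have [->|kj] := eqVneq (k, j) (0, 0); first by rewrite start.
  have : (P [set w | C 0%N w = (k, j)] <= P (~` [set w | C 0%N w = (0, 0)%R]))%E.
    apply: le_measure; rewrite ?inE//; first exact: measurableC.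
    by move=> w /= -> kj0; rewrite kj0 eqxx in kj.
  rewrite probability_setC// start subee// => P0.
  by rewrite (_ : P _ = 0%E)//; apply/eqP; rewrite eq_le P0 measure_ge0.
(* The four neighbours are the only possible predecessors of (k, j). *)
pose l := [:: (k - 1, j); (k + 1, j); (k, j - 1); (k, j + 1)].
have ul : uniq l by rewrite /l /= !inE !xpair_eqE; lia.
have finP s : P [set w | C n w = s] \is a fin_num by exact: fin_num_measure.
rewrite (markov_forward _ _ _ P _ _ C (k, j) l n walk ul); last first.
  move=> [k' j']; rewrite /l !inE !xpair_eqE /anisotropic_transition => kj.
  by rewrite !xpair_eqE !ifF//; lia.
rewrite /l !big_cons big_nil adde0 !fineD ?fin_numD ?fin_numM// !fineM//.
rewrite /anisotropic_transition !xpair_eqE /=.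
rewrite ifT; last by lia.
rewrite ifT; last by lia.
rewrite ifF; last by lia.
rewrite ifT; last by lia.
rewrite ifF; last by lia.
rewrite ifT; last by lia.
by ring.
Qed.

Theorem theorem1p2 (R : realType) (d : measure_display)
    (Omega : measurableType d) (P : probability Omega R)
    (p : int -> R) (C : nat -> Omega -> int * int) (c A delta : R)
    (p_gt0 : forall j, 0 < p j) (p_le_half : forall j, p j <= 2^-1)
    (p_inf : inf (range p) < 2^-1)
    (C_walk : anisotropic_walk P p C)
    (C_start : started_at P C (0, 0))
    (c_gt0 : 0 < c) (A_gt0 : 0 < A) (delta_gt0 : 0 < delta)
    (delta_le1 : delta <= 1)
    (p_sum : symmetric_sum (fun j => (p j)^-1)%R
             = (fun k : nat => c * k%:R `^ (1 + A))%R
             +O_\oo (fun k : nat => k%:R `^ (1 + A - delta))%R) :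
  transient P C.
Proof.
have [B [b [c' [B0 b0 c'0 growth]]]] :=
  conductance_growth _ _ _ _ _ c_gt0 A_gt0 delta_gt0 p_sum.
have rec := anisotropic_walk_recursion _ _ _ _ _ _ C_walk C_start.
have [mC _] := C_walk.
have hp j : 0 < p j <= 2^-1 by rewrite p_gt0 p_le_half.
pose F n := [set w | C n w = (0, 0)].
(* The division by [p 0] undoes the factor in [green] at the origin. *)
pose K := 4 * (24 * B%:R + 32 * b%:R / c') / p 0.
have finP n : P (F n) \is a fin_num by apply: fin_num_measure; exact: mC.
have partial N : (\sum_(0 <= n < N) P (F n) <= K%:E)%E.
  rewrite (eq_bigr (fun n => (fine (P (F n)))%:E)); last first.
    by move=> n _; rewrite fineK.
  rewrite sumEFin lee_fin /K ler_pdivlMr// mulrC.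
  apply: (green_bounded _ _ (fun n k j => fine (P [set w | C n w = (k, j)]))) => //.
  by move=> n k j; exact: fine_ge0.
(* Borel-Cantelli: the expected number of visits to the origin is at most K. *)
have lim_sup0 : P (lim_sup_set F) = 0%E.
  apply: lim_sup_set_cvg0; first by move=> n; exact: mC.
  apply: le_lt_trans (ltry K); apply: lime_le; last exact: nearW.
  by apply: is_cvg_nneseries.
exists (lim_sup_set F); split=> //.
  by apply: bigcap_measurableType => n _; apply: bigcup_measurable => k _; exact: mC.
move=> w; apply: contra_notP => notsup.
(* Outside the limit superior there is a time after which the origin is never visited. *)
have [n Fn] : exists n, forall k, (n <= k)%N -> C k w <> (0, 0).
  apply: contra_notP notsup => H n _.
  have /existsNP[k /not_implyP[nk /contrapT Ck]] : ~ forall k, (n <= k)%N -> C k w <> (0, 0).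
    by move=> Hn; apply: H; exists n.
  by exists k.
apply: (sub_finite_set _ (finite_II n)) => k /= [_ Ck].
by rewrite ltnNge; apply/negP => /Fn.
Qed.
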